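(* Let $n\ge 0$ and $d\ge -1$ be integers. Any subscaled lattice $L$ of sc-dimension $d$ which is generated (as an $\mathcal{L}_{\mathrm{SC}}$-structure) by $n$ elements is finite. More precisely, the number of elements of $\mathcal I(L)$ is bounded by $\mu(n,d)$, where $\mu$ is the function defined recursively by $$\mu(n,-1)=0\quad(\forall n),\qquad \mu(n,d)=2^n+\mu(2^{n+1},d-1)\quad(\forall n,\ \forall d\ge 0).$$
   Context: Conventions: $\mathbb{N}=\{0,1,2,\dots\}$. Lattices have a least element $\mathbf 0$ and a greatest element $\mathbf 1$ ($\mathbf 0=\mathbf 1$ is allowed), in the language $\mathcal{L}_{\mathrm{lat}}=\{\mathbf 0,\mathbf 1,\vee,\wedge\}$; an empty join is $\mathbf 0$. In a lattice, $b\ll a$ means: $b\le a\ne\mathbf 0$ and for every $c<a$ one has $b\vee c<a$. $\mathcal I(L)$ is the set of non-zero $\vee$-irreducible elements of $L$. A TC-lattice is a lattice with an additional binary operation $-$ such that $a-b$ is the least element $c$ with $a\le b\vee c$ (it is then distributive); $\mathcal{L}_{\mathrm{TC}}=\mathcal{L}_{\mathrm{lat}}\cup\{-\}$. For $d\in\mathbb{N}$, $\mathcal{L}_{\mathrm{SC}_d}=\mathcal{L}_{\mathrm{TC}}\cup\{\mathrm{C}^0,\dots,\mathrm{C}^d\}$ with unary function symbols $\mathrm{C}^i$. Put $\operatorname{sc-dim} a=\min\{l\in\{-1,0,\dots,d\}: a=\bigvee_{0\le i\le l}\mathrm{C}^i(a)\}$ ($\infty$ if there is no such $l$). A $d$-subscaled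 lattice is an $\mathcal{L}_{\mathrm{SC}_d}$-structure which is a TC-lattice and satisfies, for all elements $a,b$: (1) $\bigvee_{0\le i\le d}\mathrm{C}^i(a)=a$; (2) for all $I\subseteq\{0,\dots,d\}$ and all $k$: $\mathrm{C}^k(\bigvee_{i\in I}\mathrm{C}^i(a))$ equals $\mathrm{C}^k(a)$ if $k\in I$ and $\mathbf 0$ if $k\notin I$; (3) for $k\ge\max(\operatorname{sc-dim}a,\operatorname{sc-dim}b)$: $\mathrm{C}^k(a\vee b)=\mathrm{C}^k(a)\vee\mathrm{C}^k(b)$; (4) for $i\ne j$: $\operatorname{sc-dim}(\mathrm{C}^i(a)\wedge\mathrm{C}^j(a))<\min(i,j)$; (5) for $k\ge\operatorname{sc-dim}b$: $\mathrm{C}^k(a)-b=\mathrm{C}^k(a)-\mathrm{C}^k(b)$; (6) if $b\ll a$ then $\operatorname{sc-dim}b<\operatorname{sc-dim}a$. $\mathcal{L}_{\mathrm{SC}}=\mathcal{L}_{\mathrm{TC}}\cup\{\mathrm{C}^i\}_{i\in\mathbb{N}}$. A subscaled lattice is an $\mathcal{L}_{\mathrm{SC}}$-structure whose $\mathcal{L}_{\mathrm{SC}_d}$-reduct is a $d$-subscaled lattice for every large enough $d$ (then $\mathrm{C}^i$ is constantly $\mathbf 0$ for large $i$ and $\operatorname{sc-dim}$ does not depend on the choice of large $d$). The sc-dimension of $L$ is $\operatorname{sc-dim}\mathbf 1$. *)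

(* Defs.v *)
From mathcomp Require Import all_boot all_order all_algebra.
From mathcomp Require Import boolp classical_sets cardinality constructive_ereal.

Set Implicit Arguments.
Unset Strict Implicit.
Unset Printing Implicit Defensive.

Import Order.TTheory GRing.Theory Num.Theory.

Local Open Scope order_scope.

Section LatticeNotions.
Context {disp : Order.disp_t} {L : tbLatticeType disp}.

Definition strongly_below (b a : L) : Prop :=
  [/\ b <= a, a != \bot & forall c, c < a -> b `|` c < a].

Definition join_irreducible (a : L) : Prop :=
  forall b c, a = b `|` c -> a = b \/ a = c.

Definition nonzero_join_irreducibles : set L :=
  [set a | a != \bot /\ join_irreducible a]%classic.

Definition TC_lattice (minus : L -> L -> L) : Prop :=
  forall a b, a <= b `|` minus a b
    /\ forall c, a <= b `|` c -> minus a b <= c.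

End LatticeNotions.

Section SubscaledD.
Context {disp : Order.disp_t} {L : tbLatticeType disp} {d : nat}.
Variables (minus : L -> L -> L) (C : 'I_d.+1 -> L -> L).

(* The sc-dimension, with values in {-1, 0, ..., d, +oo}. The index m computed
   by [find] is l + 1, where l is the least element of {-1, 0, ..., d} such that
   a is the join of the C i a for 0 <= i <= l; m = d.+2 when there is none. *)
Definition scdim (a : L) : \bar int :=
  let m := find (fun m => a == \join_(i < d.+1 | (i < m)%N) C i a)
                (iota 0 d.+2) in
  if (m < d.+2)%N then ((m%:Z - 1)%R)%:E else +oo%E.

Record d_subscaled : Prop := DSubscaled {
  d_subscaled_TC : TC_lattice minus;
  d_subscaled_join : forall a, \join_(i < d.+1) C i a = a;
  d_subscaled_proj : forall a (I : {set 'I_d.+1}) k,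
    C k (\join_(i in I) C i a) = if k \in I then C k a else \bot;
  d_subscaled_joinD : forall a b (k : 'I_d.+1),
    (maxe (scdim a) (scdim b) <= (k%:Z)%:E)%E ->
    C k (a `|` b) = C k a `|` C k b;
  d_subscaled_meet : forall a (i j : 'I_d.+1), i != j ->
    (scdim (C i a `&` C j a) < ((minn i j)%:Z)%:E)%E;
  d_subscaled_minus : forall a b (k : 'I_d.+1),
    (scdim b <= (k%:Z)%:E)%E -> minus (C k a) b = minus (C k a) (C k b);
  d_subscaled_ll : forall a b, strongly_below b a -> (scdim b < scdim a)%E
}.

End SubscaledD.

Section Subscaled.
Context {disp : Order.disp_t} {L : tbLatticeType disp}.
Variables (minus : L -> L -> L) (C : nat -> L -> L).

Definition SC_reduct (d : nat) : 'I_d.+1 -> L -> L := fun i => C i.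

Definition subscaled_lattice : Prop :=
  exists d0 : nat, forall d, (d0 <= d)%N -> d_subscaled minus (SC_reduct (d := d)).

(* The sc-dimension of L is the common value of the sc-dimension of \top in
   the reducts of large index. *)
Definition has_scdimension (s : int) : Prop :=
  exists d0 : nat, forall d, (d0 <= d)%N ->
    scdim (SC_reduct (d := d)) (\top : L) = s%:E.

Definition SC_closed (S : set L) : Prop :=
  [/\ S \bot, S \top,
      forall a b, S a -> S b -> [/\ S (a `|` b), S (a `&` b) & S (minus a b)]
    & forall i a, S a -> S (C i a)].

Definition SC_generated (A : set L) : set L := smallest SC_closed A.

End Subscaled.

Fixpoint mu_nat (n d : nat) : nat :=
  (2 ^ n + if d is d'.+1 then mu_nat (2 ^ n.+1) d' else 0)%N.

(* Only used for d >= -1; the value 0 at d < -1 is junk. *)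
Definition mu (n : nat) (d : int) : nat :=
  if d is Posz d' then mu_nat n d' else 0%N.

Lemma muN1 n : mu n (- 1)%R = 0%N.
Proof. by []. Qed.

Lemma muE n (d : int) : (0 <= d)%R ->
  mu n d = (2 ^ n + mu (2 ^ n.+1) (d - 1)%R)%N.
Proof. by case: d => // -[|d] _ //=; rewrite subn1. Qed.

(* Main.v *)
(* Induction on the sc-dimension d, carried out inside the intervals below an
   element m. The map a |-> C^d(a) is a homomorphism onto a Boolean algebra of
   d-pure elements, so the n generators x_i cut C^d(m) into 2^n pure pieces y_k
   that meet pairwise in dimension < d. Write x^- for the join of the C^i(x)
   with i < d, and let M be the join of m^-, the x_i^- and the y_j /\ y_k
   (j <> k). By induction the 1 + n + 2^n <= 2^(n+1) elements m^-, x_i^- and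
   y_k /\ M generate a finite structure T below M. Then the elements y_A \/ a,
   with y_A a join of pieces and a in T, form a structure containing the
   generators: the one delicate point is that (y_A \/ a)^- = a - y_A, which
   lies in T because it equals a - (y_A /\ M). Hence every element is a join of
   at most 2^n + mu(2^(n+1), d-1) fixed elements, among which all non-zero
   join-irreducibles must occur. *)

Require Import Defs.
From mathcomp Require Import all_boot all_order all_algebra.
From mathcomp Require Import boolp classical_sets cardinality constructive_ereal.
From mathcomp Require Import zify.

Set Implicit Arguments.
Unset Strict Implicit.
Unset Printing Implicit Defensive.

Import Order.TTheory GRing.Theory Num.Theory.

Local Open Scope order_scope.

Lemma lte_int_le (u : \bar int) (z : int) :
  (u < z%:E)%E -> (u <= (z - 1)%R%:E)%E.
Proof. by case: u => [r||] //; rewrite ?leNye // lte_fin lee_fin; lia. Qed.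

(** * Calculus of the difference in a TC-lattice *)

Section TCLattice.
Context {disp : Order.disp_t} {L : tbLatticeType disp}.
Variable minus : L -> L -> L.
Hypothesis minusP : TC_lattice minus.
Implicit Types a b c : L.
Local Notation "a - b" := (minus a b) : order_scope.

Lemma minus_leE a b c : (a - b <= c) = (a <= b `|` c).
Proof.
have [ab abP] := minusP a b.
by apply/idP/idP => [le_c|/abP//]; apply: le_trans ab _; rewrite leU2.
Qed.

(** By [minus_leE], [_ - a] is left adjoint to joining with [a], and a right adjoint preserves
    meets. *)
Lemma joinIr_TC a b c : a `|` (b `&` c) = (a `|` b) `&` (a `|` c).
Proof.
apply/le_anti/andP; split; first by rewrite lexI !leU2 ?leIl ?leIr.
by rewrite -minus_leE lexI !minus_leE leIl leIr.
Qed.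

Lemma meetUr_TC a b c : a `&` (b `|` c) = (a `&` b) `|` (a `&` c).
Proof.
rewrite joinIr_TC (joinC _ a) meetKU (joinC (a `&` b)) joinIr_TC meetA (joinC c a).
by rewrite joinKI joinC.
Qed.

Lemma meet_joins_TC (I : Type) (r : seq I) (P : pred I) (F : I -> L) a :
  a `&` \join_(i <- r | P i) F i = \join_(i <- r | P i) (a `&` F i).
Proof. exact: (big_morph _ (meetUr_TC a) (meetx0 a)). Qed.

Lemma minusUl a b c : (a `|` b) - c = (a - c) `|` (b - c).
Proof.
apply/le_anti/andP; split.
  by rewrite minus_leE leUx -(minus_leE a) -(minus_leE b) leUl leUr.
by rewrite leUx !minus_leE -leUx -minus_leE.
Qed.

Lemma minus0x a : \bot - a = \bot.
Proof. by apply/eqP; rewrite -lex0 minus_leE le0x. Qed.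

Lemma minus_joins (I : Type) (r : seq I) (P : pred I) (F : I -> L) a :
  (\join_(i <- r | P i) F i) - a = \join_(i <- r | P i) (F i - a).
Proof. exact: (big_morph (fun b => b - a) (fun b c => minusUl b c a) (minus0x a)). Qed.

Lemma minusx0 a : a - \bot = a.
Proof.
apply/le_anti; rewrite minus_leE join0x lexx /=.
by rewrite -[leRHS]join0x -minus_leE lexx.
Qed.

Lemma minusxx a : a - a = \bot.
Proof. by apply/eqP; rewrite -lex0 minus_leE joinx0. Qed.

Lemma minus_le a b : a - b <= a.
Proof. by rewrite minus_leE leUr. Qed.

Lemma minus_meetr a b : a - (a `&` b) = a - b.
Proof.
apply/le_anti/andP; split; rewrite minus_leE.
  by rewrite joinC joinIr_TC lexI leUr /= joinC -minus_leE lexx.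
apply: (@le_trans _ _ ((a `&` b) `|` (a - (a `&` b)))); first by rewrite -minus_leE.
by rewrite leU2 // leIr.
Qed.

Lemma minusxU a b c : a - (b `|` c) = (a - b) - c.
Proof.
apply/le_anti/andP; split; first by rewrite minus_leE -joinA -!minus_leE lexx.
by rewrite !minus_leE joinA -minus_leE lexx.
Qed.

(** If b ∨ c were equal to [a], then [a - b], that is [a], would lie below c. This lets
    [d_subscaled_ll] be applied to differences. *)
Lemma strongly_below_minus a b :
  b <= a -> a != \bot -> a - b = a -> strongly_below b a.
Proof.
move=> ba a0 abE; split=> // c ca; rewrite lt_neqAle leUx ba (ltW ca) !andbT.
apply/eqP => bcE; have : a - b <= c by rewrite minus_leE bcE.
by rewrite abE (lt_geF ca).
Qed.
End TCLattice.

(** * Components and dimension in a subscaled lattice *)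

Section Subscaled.
Context {disp : Order.disp_t} {L : tbLatticeType disp}.
Variables (minus : L -> L -> L) (C : nat -> L -> L) (D : nat).
Hypothesis subscaled : d_subscaled minus (SC_reduct C (d := D)).
Hypothesis C_big : forall i a, (D < i)%N -> C i a = \bot.
Implicit Types (a b c m : L) (i l : nat).
Local Notation "a - b" := (minus a b) : order_scope.

Let minusP : TC_lattice minus := d_subscaled_TC subscaled.

(* The condition [scdim a < l]; see [scdim_leE]. *)
Definition below_dim l a := forall k, (l <= k)%N -> C k a = \bot.

(** With [l] in place of d, this is the x^- of the overview. *)
Definition lower_part l a := \join_(i < D.+1 | (i < l)%N) C i a.

Lemma C_join a : \join_(i < D.+1) C i a = a.
Proof. exact: d_subscaled_join subscaled a. Qed.

Lemma C_le i a : C i a <= a.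
Proof.
have [Di|iD] := ltnP D i; first by rewrite C_big ?le0x.
rewrite -[leRHS]C_join.
exact: (joins_sup (j := Ordinal (iD : i < D.+1)%N) (P := predT) (fun j => C j a)).
Qed.

Lemma C_bot i : C i \bot = \bot.
Proof. by apply/eqP; rewrite -lex0 C_le. Qed.

Lemma C_lower_part k l a :
  C k (lower_part l a) = if (k < l)%N then C k a else \bot.
Proof.
have [Dk|kD] := ltnP D k; first by rewrite !C_big ?if_same.
have := d_subscaled_proj subscaled a [set i : 'I_D.+1 | (i < l)%N]%SET
  (Ordinal (kD : k < D.+1)%N).
rewrite /SC_reduct inE /= => <-; congr (C k _).
by apply: eq_bigl => i; rewrite inE.
Qed.

Lemma C_C k i a : C k (C i a) = if k == i then C k a else \bot.
Proof.
have [Di|iD] := ltnP D i.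
  by rewrite (C_big _ Di) C_bot; case: eqP => [->|//]; rewrite C_big.
have [Dk|kD] := ltnP D k; first by rewrite !C_big ?if_same.
have := d_subscaled_proj subscaled a [set Ordinal (iD : i < D.+1)%N]%SET
  (Ordinal (kD : k < D.+1)%N).
by rewrite /SC_reduct inE /= big_set1.
Qed.

Lemma lower_part_le l a : lower_part l a <= a.
Proof. by apply/joinsP => i _; apply: C_le. Qed.

Lemma below_lower_part l a : below_dim l (lower_part l a).
Proof. by move=> k lk; rewrite C_lower_part ltnNge lk. Qed.

Lemma below_C i a : below_dim i.+1 (C i a).
Proof. by move=> k ik; rewrite C_C gtn_eqF. Qed.

Lemma lower_partE l a : below_dim l a -> lower_part l a = a.
Proof.
move=> la; rewrite -[RHS]C_join /lower_part big_mkcond.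
by apply: eq_bigr => i _; case: ltnP => // /la ->.
Qed.

Lemma below_dimW l l' a : (l <= l')%N -> below_dim l a -> below_dim l' a.
Proof. by move=> ll' la k l'k; apply: la; apply: leq_trans l'k. Qed.

Lemma C_lower_partE l a : below_dim l.+1 a -> a = C l a `|` lower_part l a.
Proof.
move=> la; apply/le_anti; rewrite leUx C_le lower_part_le !andbT.
rewrite -[leLHS]C_join; apply: joins_le => i _.
have [il|li|->] := ltngtP i l; last by rewrite leUl.
  by apply: le_trans (leUr _ _); apply: joins_sup.
by rewrite la // le0x.
Qed.

(** The search in [scdim] stops at the dimension plus one, whence the shift. If it stops at m, every
    component of index at least m vanishes by projection; conversely, [lower_partE] makes it stop at
    [l] or before. *)
Lemma scdim_leE l a : (l <= D.+1)%N ->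
  (scdim (SC_reduct C (d := D)) a <= (l%:Z - 1)%R%:E)%E <-> below_dim l a.
Proof.
move=> lD; rewrite /scdim.
set p := (X in find X _); set m := find _ _.
split.
  case: ifP => // mD; rewrite lee_fin => ml.
  have /eqP aE : p m.
    have := @nth_find _ 0%N p (iota 0 D.+2).
    by rewrite -/m nth_iota // add0n; apply; rewrite has_find size_iota.
  move=> k lk; rewrite aE -[X in C k X]/(lower_part m a) C_lower_part ltnNge.
  by rewrite (_ : m <= k)%N //; lia.
move=> /lower_partE aE.
have pl : p l by rewrite /p -[X in _ == X]/(lower_part l a) aE.
have ml : (m <= l)%N.
  rewrite leqNgt; apply/negP => /(before_find 0%N).
  by rewrite nth_iota // add0n pl.
by rewrite (leq_ltn_trans ml) // lee_fin; lia.
Qed.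

Lemma below_dim_max a : below_dim D.+1 a.
Proof. by move=> k Dk; apply: C_big. Qed.

(** Downward induction on k: when C^k(a) is to be shown zero, [a] may be assumed of dimension at
    most k, the range in which C^k is additive. *)
Lemma below_dim_pred l a :
  (forall k, (l <= k)%N -> below_dim k.+1 a -> C k a = \bot) -> below_dim l a.
Proof.
move=> lP.
(* The bound descends from [D.+1] by one degree for each j and is cut off at [l]. *)
suff : forall j, below_dim (maxn l (D.+1 - j)) a.
  by move=> /(_ D.+1); rewrite subnn maxn0.
elim=> [|j IHj]; first by apply: below_dimW (@below_dim_max a); rewrite subn0 leq_maxr.
move=> k kP; have [k'|k'] := leqP (maxn l (D.+1 - j)) k; first exact: IHj.
apply: lP; first lia.
by apply: below_dimW IHj; lia.
Qed.

Lemma C_joinD k a b : below_dim k.+1 a -> below_dim k.+1 b ->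
  C k (a `|` b) = C k a `|` C k b.
Proof.
move=> ka kb; have [Dk|kD] := ltnP D k; first by rewrite !C_big ?joinx0.
apply: (d_subscaled_joinD subscaled (k := Ordinal (kD : k < D.+1)%N)).
have e : (k%:Z = k.+1%:Z - 1)%R by lia.
by rewrite ge_max /= e; apply/andP; split; apply/scdim_leE.
Qed.

Lemma below_dimU l a b : below_dim l a -> below_dim l b -> below_dim l (a `|` b).
Proof.
move=> la lb k lk; rewrite C_joinD ?la ?lb ?joinx0 //;
  by apply: below_dimW; last (by eassumption); apply: leqW.
Qed.

Lemma below_dim_bot l : below_dim l \bot.
Proof. by move=> k _; apply: C_bot. Qed.

Lemma below_dim_joins l (I : Type) (r : seq I) (P : pred I) (F : I -> L) :
  (forall x : I, P x -> below_dim l (F x)) -> below_dim l (\join_(x <- r | P x) F x).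
Proof.
by move=> lF; apply: big_ind => //; [exact: below_dim_bot|exact: below_dimU].
Qed.

(** Once [a] is known to have dimension at most k, additivity gives C^k(a) ≤ C^k(a ∨ b) = C^k(b) =
    0. *)
Lemma below_dim_le l a b : a <= b -> below_dim l b -> below_dim l a.
Proof.
move=> ab lb; apply: below_dim_pred => k lk ka; apply/eqP; rewrite -lex0 -(lb k lk).
have kb : below_dim k.+1 b by apply: below_dimW lb; apply: leqW.
by rewrite -(join_r ab) C_joinD // leUl.
Qed.

Lemma C_mono k a b : below_dim k.+1 b -> a <= b -> C k a <= C k b.
Proof.
by move=> kb ab; rewrite -(join_r ab) C_joinD ?leUl //; apply: below_dim_le ab kb.
Qed.

Lemma below_dim_C k a : below_dim k.+1 a -> C k a = \bot -> below_dim k a.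
Proof.
by move=> ka kaE j; rewrite leq_eqVlt => /predU1P[<-//|/ka].
Qed.

Lemma C_joins k (I : Type) (r : seq I) (P : pred I) (F : I -> L) :
  (forall x : I, P x -> below_dim k.+1 (F x)) ->
  C k (\join_(x <- r | P x) F x) = \join_(x <- r | P x) C k (F x).
Proof.
move=> kF; elim: r => [|x r IHr]; first by rewrite !big_nil C_bot.
rewrite !big_cons; case: ifP => // Px.
by rewrite C_joinD ?IHr //; [exact: kF|exact: below_dim_joins].
Qed.

Lemma below_dim_meetC i k a : i != k -> below_dim (minn i k) (C i a `&` C k a).
Proof.
move=> ik; have [Di|iD] := ltnP D i.
  by rewrite C_big // meet0x; apply: below_dim_bot.
have [Dk|kD] := ltnP D k.
  by rewrite (C_big _ Dk) meetx0; apply: below_dim_bot.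
apply/scdim_leE; first by rewrite geq_min (leqW iD).
have := d_subscaled_meet subscaled a (i := Ordinal (iD : i < D.+1)%N)
  (j := Ordinal (kD : k < D.+1)%N) ik; rewrite /SC_reduct /=.
exact: lte_int_le.
Qed.

Lemma C_minus k a b : below_dim k.+1 b -> C k a - b = C k a - C k b.
Proof.
move=> kb; have [Dk|kD] := ltnP D k; first by rewrite !C_big // !(minus0x minusP).
apply: (@d_subscaled_minus _ _ _ _ _ subscaled a b (Ordinal (kD : k < D.+1)%N)).
have e : (k%:Z = k.+1%:Z - 1)%R by lia.
by rewrite /= e; apply/scdim_leE.
Qed.

Lemma below_dim_strongly k a b :
  below_dim k.+1 a -> strongly_below b a -> below_dim k b.
Proof.
move=> ka ba; have [kD|Dk] := leqP k D; last first.
  by apply: below_dimW (@below_dim_max b).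
have /scdim_leE := ka => /(_ kD).
have := d_subscaled_ll subscaled ba.
set u := scdim _ b; set v := scdim _ a => uv vk.
apply/scdim_leE; first exact: leqW.
have {uv vk} := lt_le_trans uv vk.
rewrite (_ : k.+1%:Z - 1 = k%:Z)%R; [exact: lte_int_le|lia].
Qed.

(** * Pure elements and their decomposition into pieces *)

Section Pure.
Variable l : nat.

Lemma pure_below y : C l y = y -> below_dim l.+1 y.
Proof. by move=> <-; apply: below_C. Qed.

(** By [C_minus], subtracting [b] from a pure element amounts to subtracting C^l(b), here zero. *)
Lemma pure_minus_id y b :
  C l y = y -> below_dim l.+1 b -> C l b = \bot -> y - b = y.
Proof. by move=> yE lb bE; rewrite -{1}yE C_minus // bE yE (minusx0 minusP). Qed.

(** Applying C^l to y ≤ b ∨ (y - b) yields y ≤ b ∨ C^l(y - b), and [y - b] is the least solution. *)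
Lemma pure_minus y b : C l y = y -> below_dim l.+1 b -> C l (y - b) = y - b.
Proof.
move=> yE lb; have ly := pure_below yE.
have lc : below_dim l.+1 (y - b) by apply: below_dim_le ly; apply: (minus_le minusP).
have le : below_dim l.+1 (b `|` C l (y - b)) by apply: below_dimU => //; apply: below_C.
have ld : below_dim l.+1 (lower_part l (y - b)).
  by apply: below_dim_le lc; apply: lower_part_le.
apply/le_anti; rewrite C_le /= (minus_leE minusP) //.
apply: le_trans (C_le l _).
have : C l y <= C l ((b `|` C l (y - b)) `|` lower_part l (y - b)).
  apply: C_mono; first exact: below_dimU.
  by rewrite -joinA -C_lower_partE // -(minus_leE minusP).
by rewrite yE C_joinD // C_lower_part ltnn joinx0.
Qed.

(** Let w be the component in question. As w ≤ b, subtracting w does not change [y - b], so w is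
    strongly below it and has dimension < l; being l-pure, w is zero. *)
Lemma C_meet_minus y b :
  C l y = y -> below_dim l.+1 b -> C l ((y - b) `&` b) = \bot.
Proof.
move=> yE lb; have zE := pure_minus yE lb.
have [->|z0] := eqVneq (y - b) \bot; first by rewrite meet0x C_bot.
set w := C l _.
have wb : w <= b by apply: le_trans (C_le _ _) _; apply: leIr.
have wz : w <= y - b by apply: le_trans (C_le _ _) _; apply: leIl.
have /(below_dim_strongly (pure_below zE)) lw : strongly_below w (y - b).
  by apply: (strongly_below_minus minusP) => //; rewrite -(minusxU minusP) // join_l.
by rewrite -(lw l (leqnn l)) /w C_C eqxx.
Qed.

(** Apply C^l to y ≤ (y ∧ b) ∨ (y - b). *)
Lemma pure_split y b : C l y = y -> below_dim l.+1 b -> C l (y `&` b) `|` (y - b) = y.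
Proof.
move=> yE lb; have ly := pure_below yE.
have lyb : below_dim l.+1 (y `&` b) by apply: below_dim_le ly; apply: leIl.
have lmb : below_dim l.+1 (y - b) by apply: below_dim_le ly; apply: (minus_le minusP).
apply/le_anti; rewrite leUx (minus_le minusP) // (le_trans (C_le _ _)) ?leIl //=.
rewrite -{1}yE -[in leRHS](pure_minus yE lb) -C_joinD //.
by apply: C_mono; [apply: below_dimU|rewrite -(minus_leE minusP) // (minus_meetr minusP)].
Qed.

Lemma C_pureU y a : C l y = y -> below_dim l a -> C l (y `|` a) = y.
Proof.
move=> yE la; rewrite C_joinD ?yE ?la ?joinx0 //; first exact: pure_below.
exact: below_dimW la.
Qed.

Lemma lower_part_pureU y a :
  C l y = y -> below_dim l a -> lower_part l (y `|` a) = a - y.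
Proof.
move=> yE la; set b := y `|` a.
have bE : C l b = y by apply: C_pureU.
have lb : below_dim l.+1 b.
  by apply: below_dimU (pure_below yE) _; apply: below_dimW la.
(* C^i(b) meets y = C^l(b) in dimension < i, so subtracting y does not change it. *)
have dE : lower_part l b - y = lower_part l b.
  rewrite (minus_joins minusP) //; apply: eq_bigr => i il.
  have lm : below_dim i (C i b `&` y).
    rewrite -[X in _ `&` X]bE -{1}(minn_idPl (ltnW il)).
    by apply: below_dim_meetC; rewrite neq_ltn il.
  rewrite -(minus_meetr minusP) // C_minus; last exact: below_dimW lm.
  by rewrite lm // (minusx0 minusP).
(* [b - y] is computed twice, from b = C^l(b) ∨ b^- and from b = y ∨ a. *)
have bmE : b - y = lower_part l b.
  by rewrite {1}(C_lower_partE lb) (minusUl minusP) // bE (minusxx minusP) // join0x.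
by rewrite -bmE (minusUl minusP) // (minusxx minusP) // join0x.
Qed.

(** Each new x splits every piece into two by [pure_split], so the number of pieces doubles. A piece
    then lies inside x or meets it in dimension < l. *)
Lemma pure_atoms m (s : seq L) :
    below_dim l.+1 m -> {in s, forall x, below_dim l.+1 x} ->
  exists (K : finType) (y : K -> L),
    [/\ #|K| = (2 ^ size s)%N, forall k, C l (y k) = y k,
        \join_k y k = C l m,
        forall j k, j != k -> C l (y j `&` y k) = \bot
      & forall k, {in s, forall x, y k <= x \/ C l (y k `&` x) = \bot}].
Proof.
move=> lm; elim: s => [|x s IHs] ls.
  exists unit, (fun=> C l m); split=> //.
  - by rewrite card_unit.
  - by move=> _; rewrite C_C eqxx.
  - by rewrite (big_pred1 tt) // => -[].
have lx : below_dim l.+1 x by apply: ls; rewrite mem_head.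
have {}ls : {in s, forall z, below_dim l.+1 z}.
  by move=> z zs; apply: ls; rewrite inE zs orbT.
have {IHs}[K [y [cardK yE yS yI ys]]] := IHs ls.
(* The boolean tells the part inside x from the part outside. *)
pose y' (p : K * bool) := if p.2 then C l (y p.1 `&` x) else y p.1 - x.
have y'_le (k : K) e : y' (k, e) <= y k.
  rewrite /y'; case: ifP => _; last exact: (minus_le minusP).
  by apply: le_trans (C_le _ _) (leIl _ _).
have lI a k : below_dim l.+1 (y k `&` a).
  by apply: below_dim_le (leIl _ _) _; apply: pure_below.
have CI k a b : b <= y k -> C l (y k `&` a) = \bot -> C l (b `&` a) = \bot.
  by move=> bk ka; apply/eqP; rewrite -lex0 -ka; apply: C_mono => //; rewrite leI2.
exists (K * bool)%type, y'; split.
- by rewrite card_prod cardK card_bool expnSr.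
- move=> [k []]; rewrite /y' /=; first by rewrite C_C eqxx.
  exact: pure_minus.
- rewrite -yS -(pair_bigA _ (fun k e => y' (k, e))) /=.
  by apply: eq_bigr => k _; rewrite big_bool /y' /= pure_split.
- have yx k : C l (y' (k, false) `&` y' (k, true)) = \bot.
    rewrite /y' /=; apply/eqP; rewrite -lex0 -(C_meet_minus (yE k) lx).
    apply: C_mono; last first.
      by rewrite leI2 //; apply: le_trans (C_le _ _) (leIr _ _).
    by apply: below_dim_le (leIl _ _) _; apply: below_dim_le (minus_le minusP _ _) _;
      apply: pure_below.
  move=> [j b] [k c] jk; have [ejk|njk] := eqVneq j k.
    move: jk; rewrite ejk xpair_eqE eqxx /=.
    by case: b c => [] [] // _; rewrite ?yx // meetC yx.
  apply: (CI j) => //.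
  rewrite meetC; apply: (CI k) => //.
  by rewrite meetC yI.
- move=> [k b] z; rewrite inE => /predU1P[->|/ys zP].
    case: b; rewrite /y' /=; [left|right].
      by apply: le_trans (C_le _ _) (leIr _ _).
    exact: C_meet_minus.
  have [kz|kz] := zP k; [left|right].
    by apply: le_trans kz.
  by apply: CI kz.
Qed.

End Pure.

(* Substructures of the interval from [\bot] to [m], described inside [L]. *)
Definition closed_below m (T : set L) :=
  [/\ T \bot, T m,
      forall a b, T a -> T b -> [/\ T (a `|` b), T (a `&` b) & T (a - b)],
      forall i a, T a -> T (C i a)
    & forall a, T a -> a <= m].

(** * Adjoining the pure pieces to a structure below M *)

Section Step.
Variables (l : nat) (m M : L) (K : finType) (y : K -> L) (T : set L).
Hypothesis lm : below_dim l.+1 m.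
Hypothesis yE : forall k, C l (y k) = y k.
Hypothesis yS : \join_k y k = C l m.
Hypothesis yI : forall j k, j != k -> C l (y j `&` y k) = \bot.
Hypothesis Mm : M <= m.
Hypothesis lM : below_dim l M.
Hypothesis yM : forall j k, j != k -> y j `&` y k <= M.
Hypothesis TP : closed_below M T.
Hypothesis Tm : T (lower_part l m).
Hypothesis Ty : forall k, T (y k `&` M).

Let yU (A : {set K}) := \join_(k in A) y k.

Definition adjoin_atoms : set L :=
  fun b => exists (A : {set K}) (a : L), T a /\ b = yU A `|` a.

Let ly k : below_dim l.+1 (y k). Proof. exact: pure_below. Qed.

Lemma yU_pure A : C l (yU A) = yU A.
Proof. by rewrite C_joins //; apply: eq_bigr => k _. Qed.

Lemma T_yU A : T (yU A `&` M).
Proof.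
have [T0 _ Top _ _] := TP.
rewrite meetC (meet_joins_TC minusP) //; apply: big_ind => // [a b Ta Tb|k _].
  by have [] := Top a b Ta Tb.
by rewrite meetC.
Qed.

Let T_le a : T a -> a <= M. Proof. by have [_ _ _ _] := TP; apply. Qed.

Let T_below a : T a -> below_dim l a.
Proof. by move=> /T_le aM; apply: below_dim_le lM. Qed.

(** After distributing, the diagonal terms give [A :&: B], and the overlaps of distinct pieces lie
    in M, so the traces on M absorb them. *)
Lemma yU_meet A B : yU A `&` yU B =
  yU (A :&: B) `|` ((yU A `&` M) `&` (yU B `&` M)).
Proof.
apply/le_anti/andP; split; last first.
  rewrite leUx [X in _ && X]leI2 ?leIl // andbT.
  by apply/joinsP => k /setIP[kA kB]; rewrite lexI !joins_sup.
rewrite (meet_joins_TC minusP) //; apply/joinsP => k kB.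
rewrite meetC (meet_joins_TC minusP) //; apply/joinsP => j jA.
have [ejk|njk] := eqVneq j k.
  apply: le_trans (leUl _ _); apply: le_trans (leIl _ _) _.
  by apply: joins_sup; rewrite inE -{1}ejk jA kB.
apply: le_trans (leUr _ _); rewrite meetC !lexI yM // !andbT.
by rewrite (le_trans (leIl _ _)) ?(le_trans (leIr _ _)) //; apply: joins_sup.
Qed.

(** Pieces in [B] are removed entirely. A piece outside [B] meets the subtracted element in
    dimension < l, so it survives intact. *)
Lemma yU_minus A B b : T b -> yU A - (yU B `|` b) = yU (A :\: B).
Proof.
move=> Tb; rewrite (minus_joins minusP) // (bigID (mem B)) /= big1 ?join0x; last first.
  move=> k /andP[_ kB]; apply/eqP; rewrite -lex0 (minus_leE minusP) // joinx0.
  by apply: le_trans (leUl _ _); apply: joins_sup.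
apply: eq_big => [k|k /andP[_ kB]]; first by rewrite !inE andbC.
rewrite -(minus_meetr minusP) //; apply: pure_minus_id => //.
  exact: below_dim_le (leIl _ _) _.
have lI a : below_dim l.+1 (y k `&` a) by apply: below_dim_le (leIl _ _) _.
rewrite (meetUr_TC minusP) // C_joinD // (meet_joins_TC minusP) // C_joins // big1 ?join0x.
  by apply: (below_dim_le (leIr _ _) (T_below Tb)).
by move=> j jB; apply: yI; apply: contraNneq kB => ->.
Qed.

Lemma adjoin_atoms_closed : closed_below m adjoin_atoms.
Proof.
have [T0 _ Top TC _] := TP.
have TU a b : T a -> T b -> T (a `|` b) by move=> Ta /(Top a)[].
have TI a b : T a -> T b -> T (a `&` b) by move=> Ta /(Top a)[].
have Tmin a b : T a -> T b -> T (a - b) by move=> Ta /(Top a)[].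
(* Elements of [T] lie below M, so they see only the trace of [yU A] on M, which belongs to [T]. *)
have yUI a A : T a -> a `&` yU A = a `&` (yU A `&` M).
  by move=> /T_le aM; rewrite meetA [RHS]meet_l // (le_trans (leIl _ _)).
split.
- by exists finset.set0, \bot; split=> //; rewrite /yU big_set0 joinx0.
- exists finset.setT, (lower_part l m); split=> //.
  rewrite [LHS](C_lower_partE lm) -yS /yU; congr (_ `|` _).
  by apply: eq_bigl => k; rewrite inE.
- move=> _ _ [A [a [Ta ->]]] [B [b [Tb ->]]]; split.
  + exists (A :|: B), (a `|` b); split; first exact: TU.
    by rewrite /yU joins_setU joinACA.
  (* The remainder gathers the overlap term of [yU_meet] and the three products involving a or b. *)
  + exists (A :&: B), (((yU A `&` M) `&` (yU B `&` M)) `|` (b `&` (yU A `&` M))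
      `|` ((a `&` (yU B `&` M)) `|` (a `&` b))).
    have wA := T_yU A; have wB := T_yU B.
    split; first by do ![assumption | apply/TU | apply/TI].
    rewrite -(yUI b) // -(yUI a) // -joinA joinA -yU_meet (meetUr_TC minusP).
    rewrite !(meetC (yU A `|` a)) !(meetUr_TC minusP) joinACA -joinA.
    by rewrite (meetC (yU B) (yU A)) (meetC (yU B) a) (meetC b a).
  + exists (A :\: B), (a - ((yU B `&` M) `|` b)); split.
      by apply: Tmin => //; apply: TU => //; apply: T_yU.
    rewrite (minusUl minusP) // yU_minus //; congr (_ `|` _).
    rewrite -[LHS](minus_meetr minusP) // -[RHS](minus_meetr minusP) //; congr (_ - _).
    by rewrite !(meetUr_TC minusP) // -yUI.
- move=> i _ [A [a [Ta ->]]]; have yUE := yU_pure A; have la := T_below Ta.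
  have [il|li|->] := ltngtP i l.
  (* For i < l, C^i only depends on the lower part, which is a - y_A by [lower_part_pureU]. *)
  + exists finset.set0, (C i (a - (yU A `&` M))); split.
      by apply: TC; apply: Tmin => //; apply: T_yU.
    rewrite /yU big_set0 join0x -[C i (_ `|` _)](_ : C i (lower_part l (yU A `|` a)) = _).
      rewrite lower_part_pureU //; congr (C i _).
      by rewrite -(minus_meetr minusP) // yUI // (minus_meetr minusP).
    by rewrite C_lower_part il.
  + exists finset.set0, \bot; split=> //; rewrite /yU big_set0 join0x.
    suff lb : below_dim l.+1 (yU A `|` a) by rewrite lb.
    by apply: below_dimU (pure_below yUE) _; apply: below_dimW la.
  + exists A, \bot; split=> //; rewrite joinx0; exact: C_pureU.
- move=> _ [A [a [/T_le aM ->]]]; rewrite leUx (le_trans aM) // andbT.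
  apply/joinsP => k _; apply: le_trans (C_le l m); rewrite -yS.
  exact: joins_sup.
Qed.

End Step.

(** * The induction on dimension *)

Definition joins_in (J : seq L) b := b = \join_(j <- J | j <= b) j.

(** C^l(x) is the join of its meets with the pieces. Applying C^l once more kills the terms of the
    pieces that do not lie below x. *)
Lemma C_atoms (l : nat) m (K : finType) (y : K -> L) x :
    below_dim l.+1 m -> x <= m -> (forall k, C l (y k) = y k) ->
    \join_k y k = C l m ->
    (forall k, y k <= x \/ C l (y k `&` x) = \bot) ->
  C l x = \join_(k | y k <= x) y k.
Proof.
move=> lm xm yE yS yx; have lx := below_dim_le xm lm.
have ly k : below_dim l.+1 (y k) by apply: pure_below.
apply/le_anti/andP; split; last first.
  by apply/joinsP => k ykx; rewrite -yE; apply: C_mono.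
have CxE : C l x = \join_k (C l x `&` y k).
  by rewrite -(meet_joins_TC minusP) yS meet_l //; apply: C_mono.
have lI k : below_dim l.+1 (C l x `&` y k) by apply: below_dim_le (leIr _ _) _.
have -> : C l x = \join_k C l (C l x `&` y k).
  by rewrite -C_joins // -CxE C_C eqxx.
apply/joinsP => k _; have [ykx|ykx] := yx k.
  apply: le_trans (C_le _ _) _; apply: le_trans (leIr _ _) _.
  exact: joins_sup.
apply: le_trans (le0x _); rewrite -ykx; apply: C_mono.
  by apply: below_dim_le (leIl _ _) _.
by rewrite meetC leI2 ?C_le.
Qed.

(* [l] is the dimension bound plus one, so that [l = 0] stands for [-1]. *)
Lemma finitely_generated_below (l n : nat) m (s : seq L) :
    below_dim l m -> (size s <= n)%N -> {in s, forall x, x <= m} ->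
  exists (J : seq L) (T : set L),
    [/\ (size J <= mu n (l%:Z - 1)%R)%N, closed_below m T,
        {in s, forall x, T x} & forall b, T b -> joins_in J b].
Proof.
elim: l n m s => [|l IHl] n m s lm sn sm.
  have m0 : m = \bot by rewrite -(lower_partE lm) /lower_part big_pred0_eq.
  exists [::], [set \bot]%classic; split=> //.
  - split=> //=.
    + by move=> a b -> ->; rewrite joinxx meetxx (minusxx minusP).
    + by move=> i a ->; apply: C_bot.
    + by move=> a ->; apply: le0x.
  - by move=> x /sm; rewrite m0 lex0 => /eqP.
  - by move=> b ->; rewrite /joins_in big_nil.
have ls : {in s, forall x, below_dim l.+1 x}.
  by move=> x /sm xm; apply: below_dim_le xm lm.
have [K [y [cardK yE yS yI ys]]] := pure_atoms lm ls.
pose M := lower_part l m `|` (\join_(x <- s) lower_part l x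
  `|` \join_(p : K * K | p.1 != p.2) (y p.1 `&` y p.2)).
have ym k : y k <= m.
  apply: le_trans (C_le l m); rewrite -yS; exact: joins_sup.
have Mm : M <= m.
  rewrite !leUx lower_part_le /=; apply/andP; split.
    by apply/joinsP_seq => x /sm xm _; apply: le_trans (lower_part_le _ _) xm.
  by apply/joinsP => p _; apply: le_trans (leIl _ _) (ym _).
have lM : below_dim l M.
  apply: below_dimU; first exact: below_lower_part.
  apply: below_dimU; apply: below_dim_joins => p pI.
    exact: below_lower_part.
  apply: below_dim_C; last exact: yI.
  by apply: below_dim_le (leIl _ _) _; apply: pure_below.
have yM j k : j != k -> y j `&` y k <= M.
  move=> jk; do 2!apply: le_trans (leUr _ _).
  exact: (@joins_sup _ _ _ (j, k) (fun p => p.1 != p.2)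
    (fun p => y p.1 `&` y p.2)).
have sizeK : size (enum K) = (2 ^ size s)%N by rewrite -cardE.
pose s' := lower_part l m :: [seq lower_part l x | x <- s]
  ++ [seq y k `&` M | k <- enum K].
(* The count is (1 + |s|) + 2^|s|, and both summands are at most 2^n because |s| < 2^|s|. *)
have s'n : (size s' <= 2 ^ n.+1)%N.
  rewrite /s' -cat1s !size_cat 2!size_map sizeK expnS mul2n -addnn addnA.
  have sn2 : (2 ^ size s <= 2 ^ n)%N by rewrite leq_exp2l.
  by rewrite leq_add //; apply: leq_trans sn2; apply: ltn_expl.
have s'M : {in s', forall x, x <= M}.
  move=> x; rewrite inE mem_cat => /or3P[/eqP->|/mapP[z zs ->]|/mapP[k _ ->]].
  - exact: leUl.
  - apply: le_trans (leUr _ _); apply: le_trans (leUl _ _).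
    exact: joins_sup_seq.
  - exact: leIr.
have [J [T [JE TP Ts' TJ]]] := IHl _ _ _ lM s'n s'M.
have Tm : T (lower_part l m) by apply: Ts'; rewrite mem_head.
have Ty k : T (y k `&` M).
  apply: Ts'; rewrite inE mem_cat; apply/or3P/Or33/mapP.
  by exists k; rewrite ?mem_enum.
exists ([seq y k | k <- enum K] ++ J), (adjoin_atoms y T); split.
- rewrite size_cat size_map sizeK muE; last by lia.
  rewrite leq_add ?leq_exp2l //; apply: leq_trans JE _.
  by rewrite (_ : (l.+1%:Z - 1 - 1 = l%:Z - 1)%R) //; lia.
- exact: (adjoin_atoms_closed lm yE yS yI Mm lM yM TP Tm Ty).
- move=> x xs; exists [set k | y k <= x]%SET, (lower_part l x); split.
    by apply: Ts'; rewrite inE mem_cat; apply/or3P/Or32/map_f.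
  rewrite [LHS](C_lower_partE (ls x xs)); congr (_ `|` _).
  rewrite (C_atoms lm (sm x xs) yE yS) => [|k]; last exact: ys.
  by apply: eq_bigl => k; rewrite inE.
(* The pieces indexed by A, and the members of J below a, all occur among the listed elements below
   b. *)
- move=> b [A [a [Ta bE]]]; apply/le_anti/andP; split; last exact: joins_le.
  rewrite {1}bE leUx; apply/andP; split.
    apply/joinsP => k kA; apply: (joins_sup_seq id).
      by rewrite mem_cat map_f ?mem_enum.
    by rewrite bE; apply: le_trans (leUl _ _); apply: joins_sup.
  rewrite {1}(TJ a Ta); apply/joinsP_seq => j jJ ja.
  apply: (joins_sup_seq id); first by rewrite mem_cat jJ orbT.
  by apply: le_trans ja _; rewrite bE leUr.
Qed.

End Subscaled.

(** * Finiteness and counting from a join-generating list *)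

Section JoinGenerated.
Context {disp : Order.disp_t} {L : tbLatticeType disp}.
Variable J : seq L.
Hypothesis JP : forall b : L, joins_in J b.

(** Each element is recovered from the set of positions in J whose entries lie below it. *)
Lemma join_generated_finite : finite_set [set: L]%classic.
Proof.
pose f (A : {set 'I_(size J)}) := \join_(i in A) tnth (in_tuple J) i.
apply: (@sub_finite_set _ _ (f @` setT)%classic); last first.
  exact: finite_image finite_finset.
move=> b _; exists [set i | tnth (in_tuple J) i <= b]%SET => //.
by rewrite [RHS]JP big_tnth; apply: eq_bigl => i; rewrite inE.
Qed.

Lemma join_irreducible_joins (r : seq L) (P : pred L) (b : L) :
  join_irreducible b -> b != \bot -> b = \join_(j <- r | P j) j -> b \in r.
Proof.
move=> bI b0; elim: r => [|j r IHr]; rewrite ?big_nil ?big_cons.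
  by move/eqP; rewrite (negPf b0).
rewrite inE; case: ifP => _ bE; last by rewrite IHr ?orbT.
have [bj|br] := bI _ _ bE; first by rewrite bj eqxx.
by rewrite IHr ?orbT.
Qed.

Lemma card_join_irreducibles :
  ((nonzero_join_irreducibles : set L) #<= `I_(size J))%card.
Proof.
apply: card_le_trans (card_image_le (nth \bot J) _); apply: subset_card_le.
move=> b [b0 bI]; have bJ := join_irreducible_joins bI b0 (JP b).
by exists (index b J); rewrite /= ?index_mem ?nth_index.
Qed.

End JoinGenerated.

(** * From large reducts to the whole structure *)

Lemma subscaled_C_big (disp : Order.disp_t) (L : tbLatticeType disp)
    (minus : L -> L -> L) (C : nat -> L -> L) (D i : nat) (a : L) :
  d_subscaled minus (SC_reduct C (d := D)) ->
  d_subscaled minus (SC_reduct C (d := i)) -> (D < i)%N -> C i a = \bot.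
Proof.
move=> hD hi Di.
(* The reduct at D writes a as the join of its C^j(a) with j ≤ D; projection in the reduct at i then
   annihilates C^i of that join. *)
have := d_subscaled_proj hi a [set j : 'I_i.+1 | (j < D.+1)%N]%SET ord_max.
rewrite /SC_reduct inE /= ltnS leqNgt Di /= => <-; congr (C i _).
rewrite -{1}(d_subscaled_join hD a) /SC_reduct (big_ord_widen i.+1 (C^~ a)).
  by apply: eq_bigl => j; rewrite inE.
exact: leqW.
Qed.

Theorem theorem4p1 (n : nat) (d : int) (hd : (-1 <= d)%R)
  (disp : Order.disp_t) (L : tbLatticeType disp)
  (minus : L -> L -> L) (C : nat -> L -> L)
  (hL : subscaled_lattice minus C) (hdim : has_scdimension C d)
  (x : 'I_n -> L) (hgen : (SC_generated minus C (range x) = [set: L])%classic) :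
  finite_set [set: L]%classic
  /\ ((nonzero_join_irreducibles : set L) #<= `I_(mu n d))%card.
Proof.
(* D lies past both thresholds: the axioms hold there and the dimension of the top is known. *)
have [[d0 hd0] [d1 hd1]] := (hL, hdim); pose D := maxn d0 d1.
have hD : d_subscaled minus (SC_reduct C (d := D)) by apply: hd0; apply: leq_maxl.
have C_big i a : (D < i)%N -> C i a = \bot.
  move=> Di; apply: subscaled_C_big hD _ (Di); apply: hd0.
  by apply: leq_trans (ltnW Di); apply: leq_maxl.
pose l := `|(d + 1)%R|%N; have lE : (l%:Z - 1 = d)%R by rewrite /l; lia.
have lT : below_dim C l (\top : L).
  (* Beyond [D.+1] every component vanishes, so the bound is automatic. *)
  have [lD|Dl] := leqP l D.+1; last first.
    by apply: below_dimW (ltnW Dl) _; apply: below_dim_max C_big _.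
  by apply/(scdim_leE hD C_big _ lD); rewrite lE hd1 ?leq_maxr.
have [|z _|J [T [Jn TP Tx TJ]]] :=
    finitely_generated_below hD C_big (n := n) (s := [seq x i | i <- enum 'I_n]) lT.
- by rewrite size_map size_enum_ord.
- exact: lex1.
(* T, being closed below the top, is a substructure containing the generators, hence all of L. *)
have {}TJ b : joins_in J b.
  apply: TJ; have : [set: L]%classic b by [].
  rewrite -hgen; apply: smallest_sub => [|_ [i _ <-]].
    by have [] := TP.
  by apply: Tx; apply: map_f; rewrite mem_enum.
split; first exact: join_generated_finite TJ.
apply: card_le_trans (card_join_irreducibles TJ) _.
by rewrite card_le_II -lE.
Qed.
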